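(* Let $X_1,X_2,\dots$ be i.i.d. real random variables with distribution $F$, where $F$ is a continuous distribution, and assume that its density is bounded away from $0$ in a neighborhood of its median $M$. Then for every $\delta>0$ and $\varepsilon>0$ there exists a constant $N$ such that, for all $n\ge N$, $$P\left(\exists\, i,j\in[n]:\ \left|\frac{X_i+X_j}{2}-M\right|\le\frac{1}{n^{2-\varepsilon}}\right)\ge 1-\delta .$$
   Context: $[n]=\{1,2,\dots,n\}$. The indices $i,j$ are allowed to coincide. ''Continuous distribution'' means a distribution having a density. The density $f$ is bounded away from $0$ in a neighborhood of $M$ if there exist $\alpha,\beta>0$ such that $f(x)\ge\beta$ for all $x\in[M-\alpha,M+\alpha]$. *)

(* Defs.v *)
From HB Require Import structures.
From mathcomp Require Import all_boot all_order all_algebra finmap.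
From mathcomp Require Import all_classical all_reals all_analysis.

Set Implicit Arguments.
Unset Strict Implicit.
Unset Printing Implicit Defensive.

Import Order.TTheory GRing.Theory Num.Theory.
Import numFieldNormedType.Exports.

Local Open Scope classical_set_scope.
Local Open Scope ring_scope.

(* A sequence X_1, X_2, ... is indexed from 0, so [X i] stands for X_(i+1) and
   the index set {1, ..., n} becomes 'I_n. *)
Definition mutually_independent (d : measure_display) (T : measurableType d)
    (R : realType) (P : probability T R) (X : nat -> {RV P >-> R}) : Prop :=
  forall (J : {fset nat}) (A : nat -> set R),
    (forall i, i \in J -> measurable (A i)) ->
    P (\bigcap_(i in [set` J]) (X i @^-1` A i)) =
      (\prod_(i <- J) P (X i @^-1` A i))%E.

Definition identically_distributed (d : measure_display)
    (T : measurableType d) (R : realType) (P : probability T R)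
    (X : nat -> {RV P >-> R}) (F : probability (measurableTypeR R) R) : Prop :=
  forall (i : nat) (A : set R), measurable A -> distribution P (X i) A = F A.

Definition iid (d : measure_display) (T : measurableType d) (R : realType)
    (P : probability T R) (X : nat -> {RV P >-> R})
    (F : probability (measurableTypeR R) R) : Prop :=
  mutually_independent X /\ identically_distributed X F.

Definition is_density (R : realType) (F : probability (measurableTypeR R) R)
    (f : R -> R) : Prop :=
  [/\ measurable_fun [set: R] f,
      forall x, 0 <= f x &
      forall A : set R, measurable A ->
        F A = (\int[lebesgue_measure]_(x in A) (f x)%:E)%E].

(* A median is any M with F(]-oo, M]) >= 1/2 and F([M, +oo[) >= 1/2; it is
   unique when F has a density bounded away from 0 near M. *)
Definition is_median (R : realType) (F : probability (measurableTypeR R) R)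
    (M : R) : Prop :=
  ((2^-1)%:E <= F `]-oo, M]%classic)%E /\ ((2^-1)%:E <= F `[M, +oo[%classic)%E.

Definition bounded_away_from0_near (R : realType) (f : R -> R) (M : R) : Prop :=
  exists alpha beta : R,
    [/\ 0 < alpha, 0 < beta &
        forall x, x \in `[M - alpha, M + alpha]%R -> beta <= f x].

(* Main.v *)
(* Birthday argument, with eps <= 1/2 without loss of generality. Cut
   [M, M + alpha] and its mirror image about M into about K = alpha / h cells of
   width h = n^-(2 - eps); a sample in a cell and a sample in the mirror cell
   average to within h of M. Each cell has probability at least x = beta * h.
   Split the sample into two halves of size m. As long as at most m cells are
   occupied, a point of the first half falls in a fresh cell with probability at
   least (K - m) * x, which is bounded below, and the m points of the second half
   all avoid the mirror images of s occupied cells with probability at most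
   (1 - x)^(s * m). Revealing the first half point by point bounds the
   probability of no match by
   (1 - (K - m) * x * (1 - (1 - x)^m))^m = O(1 / (h * m^2)) = O(n^-eps). *)
Require Import Defs.
From mathcomp Require Import all_boot all_order all_algebra.
From mathcomp Require Import all_classical all_reals all_analysis.
From mathcomp Require Import measurable_realfun finmap lra ring zify.

Set Implicit Arguments.
Unset Strict Implicit.
Unset Printing Implicit Defensive.

Import Order.TTheory GRing.Theory Num.Theory.
Import numFieldNormedType.Exports.

Local Open Scope classical_set_scope.
Local Open Scope ring_scope.

(** * Probabilities as real numbers *)

Section RealProbability.
Context {d : measure_display} {T : measurableType d} {R : realType}.
Variable P : probability T R.

(** Real values allow ring arithmetic; nothing is lost on measurable sets, where [P] is finite. *)
Definition pr (A : set T) : R := fine (P A).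

Lemma prE (A : set T) : measurable A -> P A = (pr A)%:E.
Proof. by move=> mA; rewrite /pr fineK// fin_num_measure. Qed.

Lemma pr_ge0 (A : set T) : 0 <= pr A.
Proof. exact/fine_ge0/measure_ge0. Qed.

Lemma pr_le1 (A : set T) : measurable A -> pr A <= 1.
Proof. by move=> mA; rewrite -lee_fin -prE// probability_le1. Qed.

Lemma le_pr (A B : set T) :
  measurable A -> measurable B -> A `<=` B -> pr A <= pr B.
Proof.
by move=> mA mB AB; rewrite -lee_fin -!prE// le_measure// in_setE.
Qed.

Lemma pr_setC (A : set T) : measurable A -> pr (~` A) = 1 - pr A.
Proof.
move=> mA; apply: EFin_inj; rewrite -prE; last exact: measurableC.
by rewrite probability_setC// prE.
Qed.

Lemma pr_bigsetU n (Q : {pred 'I_n}) (B : 'I_n -> set T) :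
  (forall i, measurable (B i)) -> trivIset setT B ->
  pr (\big[setU/set0]_(i < n | Q i) B i) = \sum_(i < n | Q i) pr (B i).
Proof.
move=> mB tB; apply: EFin_inj; rewrite -prE; last exact: bigsetU_measurable.
rewrite measure_bigsetU_ord// -sumEFin; by apply: eq_bigr => i _; exact: prE.
Qed.

Lemma pr_subU (A B C : set T) :
  measurable A -> measurable B -> measurable C -> C `<=` A `|` B ->
  pr C <= pr A + pr B.
Proof.
move=> mA mB mC CAB; have mAB := measurableU _ _ mA mB.
rewrite -lee_fin EFinD -!prE//; apply: (@le_trans _ _ (P (A `|` B))).
  by rewrite le_measure// in_setE.
exact: measureU2.
Qed.

Lemma pr_subU_bigsetU n (Q : {pred 'I_n}) (A : set T) (B : 'I_n -> set T)
    (C : set T) :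
  measurable A -> (forall i, measurable (B i)) -> measurable C ->
  C `<=` A `|` \big[setU/set0]_(i < n | Q i) B i ->
  pr C <= pr A + \sum_(i < n | Q i) pr (B i).
Proof.
move=> mA mB mC CAB.
suff [mU leU] : measurable (\big[setU/set0]_(i < n | Q i) B i) /\
    pr (\big[setU/set0]_(i < n | Q i) B i) <= \sum_(i < n | Q i) pr (B i).
  by apply: le_trans (lerD (lexx _) leU); exact: pr_subU.
elim/big_rec2: _ => [|i y D _ [mD leD]]; first by rewrite /pr measure0.
have mBD := measurableU _ _ (mB i) mD; split => //.
by apply: le_trans (lerD (lexx _) leD); exact: pr_subU.
Qed.

End RealProbability.

(** * Polynomial bounds for powers of [1 - x] *)

Lemma bernoulli_ineq (R : realDomainType) (x : R) n :
  0 <= x <= 1 -> 1 - n%:R * x <= (1 - x) ^+ n.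
Proof.
move=> /andP[x0 x1]; elim: n => [|n IH]; first by rewrite mul0r subr0.
rewrite exprS; have n0 : 0 <= n%:R :> R := ler0n _ n.
have : (1 - x) * (1 - n%:R * x) <= (1 - x) * (1 - x) ^+ n.
  by rewrite ler_wpM2l// subr_ge0.
apply: le_trans; rewrite -natr1; nra.
Qed.

(** The induction works because [(1 - x) * (1 + (n + 1) * x)] equals
    [1 + n * x - (n + 1) * x ^+ 2]. *)
Lemma exprn_1B_le (R : realFieldType) (x : R) n :
  0 <= x <= 1 -> (1 - x) ^+ n <= (1 + n%:R * x)^-1.
Proof.
move=> /andP[x0 x1]; have n0 : 0 <= n%:R :> R := ler0n _ n.
rewrite -[leRHS]mul1r ler_pdivlMr; last by nra.
elim: n n0 => [|n IH] n0; first by rewrite mul0r addr0 mulr1.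
have {IH} := IH (ler0n _ n); rewrite exprS -natr1.
have : 0 <= (1 - x) ^+ n by rewrite exprn_ge0// subr_ge0.
have : 0 <= n%:R :> R := ler0n _ n.
move: (_ ^+ n) (n%:R) => y a a0 y0 le1.
have : 0 <= y * (x ^+ 2 * (a + 1)) by rewrite !mulr_ge0 ?sqr_ge0// addr_ge0.
nra.
Qed.

(** * Collision bound for two families of disjoint cells *)

Section Collision.
Context {d d' : measure_display} {T : measurableType d} {U : measurableType d'}.
Context {R : realType}.
Variables (P : probability T R) (F : probability U R) (X : nat -> T -> U).

(** Since [A] is indexed by all of [nat], overwriting its entry [n] extends the cylinder by one
    coordinate. *)
Definition cylinder n (A : nat -> set U) : set T :=
  [set t | forall i, (i < n)%N -> A i (X i t)].

Hypothesis mX : forall i, measurable_fun setT (X i).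
Hypothesis pr_cylinder : forall n (A : nat -> set U),
  (forall i, measurable (A i)) ->
  pr P (cylinder n A) = \prod_(i < n) pr F (A i).

Lemma measurable_preimX i (A : set U) :
  measurable A -> measurable (X i @^-1` A).
Proof. by move=> mA; rewrite -[_ @^-1` _]setTI; exact: mX. Qed.

Lemma measurable_cylinder n (A : nat -> set U) :
  (forall i, measurable (A i)) -> measurable (cylinder n A).
Proof.
move=> mA; rewrite [cylinder _ _](_ : _ = \bigcap_(i < n) X i @^-1` A i)//.
by apply: bigcap_measurableType => i _; exact: measurable_preimX.
Qed.

Lemma pr_bigsetU_ge K (S : {set 'I_K}) (C : 'I_K -> set U) x :
  (forall c, measurable (C c)) -> trivIset setT C ->
  (forall c, x <= pr F (C c)) ->
  #|S|%:R * x <= pr F (\big[setU/set0]_(c < K | c \in S) C c).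
Proof.
move=> mC tC xC; rewrite pr_bigsetU// -sum1_card natr_sum mulr_suml.
by apply: ler_sum => c _; rewrite mul1r.
Qed.

(** Intersecting [Z] with cylinders replaces conditioning on the points revealed so far;
    independence enters only through [pr_cylinder]. *)
Lemma collision_free_le (K m : nat) (C D : 'I_K -> set U) (x : R) (Z : set T) :
  (forall c, measurable (C c)) -> (forall c, measurable (D c)) ->
  trivIset setT C -> trivIset setT D -> 0 <= x <= 1 ->
  (forall c, x <= pr F (C c)) -> (forall c, x <= pr F (D c)) ->
  measurable Z ->
  (forall t i j c, Z t -> (i < m)%N -> (m <= j < m + m)%N ->
     C c (X i t) -> D c (X j t) -> False) ->
  pr P Z <= (1 - (K - m)%:R * x * (1 - (1 - x) ^+ m)) ^+ m.
Proof.
move=> mC mD tC tD x01 xC xD mZ Zfree.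
have /andP[x0 x1] := x01.
set r := (1 - x) ^+ m; set rho := 1 - (_ * x * (1 - r)).
have r0 : 0 <= r by rewrite exprn_ge0// subr_ge0.
have r1 : r <= 1 by rewrite exprn_ile1 ?subr_ge0// gerBl.
(* Powers of [rho] serve as factors below, so its sign matters. Disjoint cells have total mass at
   most 1, hence [(K - m) * x <= 1]. *)
have rho0 : 0 <= rho.
  have := pr_bigsetU_ge [set: 'I_K]%SET mC tC xC.
  have : (K - m)%:R * x <= K%:R * x by rewrite ler_wpM2r// ler_nat leq_subr.
  have : pr F (\big[setU/set0]_(c < K | c \in [set: 'I_K]%SET) C c) <= 1.
    by apply: pr_le1; exact: bigsetU_measurable.
  rewrite cardsT card_ord /rho.
  have : 0 <= (K - m)%:R * x by rewrite mulr_ge0.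
  nra.
(* S consists of cells known to be occupied by the first t points, and k points
   of the first half are still to be revealed. *)
suff H k t (A : nat -> set U) (S : {set 'I_K}) : (t + k = m)%N ->
    (forall i, measurable (A i)) -> (#|S| <= t)%N ->
    (forall c, c \in S -> exists2 i, (i < t)%N & A i `<=` C c) ->
    pr P (cylinder t A `&` Z) <=
      \prod_(i < t) pr F (A i) * (r ^+ #|S| * rho ^+ k).
  have := H m 0%N (fun=> setT) finset.set0 erefl (fun=> measurableT).
  rewrite cards0 big_ord0 mul1r expr0 mul1r [_ `&` Z](_ : _ = Z).
    by apply => // c; rewrite inE.
  by rewrite setIidr.
elim: k t A S => [|k IH] t A S tm mA St SA.
(* The first half is fully revealed: each of the [m] remaining points must avoid [B], the union of
   the mirror cells of [S]. *)
- rewrite addn0 in tm; rewrite expr0 mulr1; subst t.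
  pose B := \big[setU/set0]_(c < K | c \in S) D c.
  have mB : measurable B by exact: bigsetU_measurable.
  pose A' i := if (i < m)%N then A i else ~` B.
  have mA' i : measurable (A' i) by rewrite /A'; case: ifP => // _; exact: measurableC.
  apply: (@le_trans _ _ (pr P (cylinder (m + m) A'))).
    apply: le_pr; first by apply: measurableI => //; exact: measurable_cylinder.
      exact: measurable_cylinder.
    move=> t [At Zt] j jmm; rewrite /A'; case: ltnP => jm; first exact: At.
    rewrite /B -bigcup_pred => -[c /SA[i im AiC] Dc].
    by apply: (Zfree t i j c Zt im _ _ Dc); [rewrite jm|apply/AiC/At].
  rewrite pr_cylinder// big_split_ord/=.
  under eq_bigr do rewrite /A' ltn_ord.
  under [X in _ * X <= _]eq_bigr do rewrite /A' ltnNge leq_addr/=.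
  rewrite prodr_const card_ord -exprM mulnC exprM.
  rewrite ler_wpM2l ?prodr_ge0// => [i _|]; first exact: pr_ge0.
  apply: lerXn2r; rewrite ?nnegrE ?pr_ge0 ?exprn_ge0 ?subr_ge0//.
  (* Bernoulli turns [1 - #|S| * x] into a power, so that each occupied cell contributes one factor
     [r] after [m] points. *)
  apply: le_trans (bernoulli_ineq _ _); last by [].
  by rewrite pr_setC// lerD2l lerN2; exact: pr_bigsetU_ge.
(* Case split on point [t]: outside [V] the set [S] is kept; in a fresh cell [c] it becomes
   [c |: S], which gains a factor [r]. *)
- have tk : (t.+1 + k)%N = m by rewrite addSnnS.
  pose V := \big[setU/set0]_(c < K | c \in ~: S) C c.
  have mV : measurable V by exact: bigsetU_measurable.
  pose upd E i := if i == t then E else A i.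
  have mupd E : measurable E -> forall i, measurable (upd E i).
    by move=> mE i; rewrite /upd; case: eqP.
  have step E (S' : {set 'I_K}) : measurable E -> (#|S'| <= t.+1)%N ->
      (forall c, c \in S' -> c \in S \/ E `<=` C c) ->
      pr P (cylinder t.+1 (upd E) `&` Z) <=
      \prod_(i < t) pr F (A i) * pr F E * (r ^+ #|S'| * rho ^+ k).
    move=> mE St' SE.
    have -> : \prod_(i < t) pr F (A i) * pr F E =
              \prod_(i < t.+1) pr F (upd E i).
      rewrite big_ord_recr/= /upd eqxx; congr (_ * _).
      by apply: eq_bigr => i _; rewrite ltn_eqF.
    apply: IH => //; first exact: mupd.
    move=> c /SE[/SA[i it AC]|EC]; last by exists t => //; rewrite /upd eqxx.
    by exists i; [exact: ltnW|rewrite /upd ltn_eqF].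
  have mcyl E : measurable E -> measurable (cylinder t.+1 (upd E) `&` Z).
    by move=> mE; apply: measurableI => //; apply/measurable_cylinder/mupd.
  apply: (@le_trans _ _ (pr P (cylinder t.+1 (upd (~` V)) `&` Z) +
      \sum_(c < K | c \in ~: S) pr P (cylinder t.+1 (upd (C c)) `&` Z))).
    apply: pr_subU_bigsetU.
    + by apply: mcyl; exact: measurableC.
    + by move=> c; exact: mcyl.
    + by apply: measurableI => //; exact: measurable_cylinder.
    + move=> w [Aw Zw].
      have cylE E : E (X t w) -> cylinder t.+1 (upd E) w.
        move=> EX i; rewrite ltnS leq_eqVlt /upd.
        by case: eqP => [->//|_]/= it; exact: Aw.
      have [Vw|nVw] := pselect (V (X t w)); last by left; split=> //; exact: cylE.
      right; move: Vw; rewrite /V -!bigcup_pred => -[c cS Cc].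
      by exists c => //; split=> //; exact: cylE.
  apply: (@le_trans _ _ (
      \prod_(i < t) pr F (A i) * pr F (~` V) * (r ^+ #|S| * rho ^+ k) +
      \sum_(c < K | c \in ~: S)
        \prod_(i < t) pr F (A i) * pr F (C c) * (r ^+ #|S|.+1 * rho ^+ k))).
    apply: lerD.
      by apply: step; [exact: measurableC|exact: leqW|move=> c; left].
    apply: ler_sum => c; rewrite inE => cS.
    have <- : #|c |: S|%SET = #|S|.+1 by rewrite cardsU1 cS.
    apply: step => //; first by rewrite cardsU1 cS.
    by move=> c'; rewrite !inE => /orP[/eqP->|]; [right|left].
  have := pr_bigsetU_ge (~: S)%SET mC tC xC; rewrite -/V.
  rewrite -mulr_suml -mulr_sumr -pr_bigsetU// -/V pr_setC//.
  have : (K - m)%:R * x <= #|~: S|%SET%:R * x.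
    rewrite ler_wpM2r// ler_nat cardsCs finset.setCK card_ord leq_sub2l//.
    by rewrite (leq_trans St)// -tm leq_addr.
  have : 0 <= \prod_(i < t) pr F (A i) by rewrite prodr_ge0// => i _; exact: pr_ge0.
  move: (\prod_(i < t) _) (pr F V) => p v p0 le1 le2.
  (* With [v] the mass of [V], the two cases add up to the factor [(1 - v) + v * r]. At least
     [K - m] cells are fresh, so this is at most [rho]. *)
  rewrite !exprS.
  rewrite [leLHS](_ : _ = p * (r ^+ #|S| * rho ^+ k) * (1 - v * (1 - r)));
    last by ring.
  rewrite [leRHS](_ : _ = p * (r ^+ #|S| * rho ^+ k) * rho); last by ring.
  have q0 : 0 <= p * (r ^+ #|S| * rho ^+ k).
    by apply: mulr_ge0 => //; apply: mulr_ge0; exact: exprn_ge0.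
  apply: ler_wpM2l => //.
  rewrite lerD2l lerN2 ler_wpM2r ?subr_ge0//; exact: le_trans le2.
Qed.

End Collision.

(** * Product formula, mass of the cells, and size of the collision bound *)

Lemma pr_cylinder_iid {d : measure_display} {T : measurableType d}
    {R : realType} (P : probability T R) (X : nat -> {RV P >-> R})
    (F : probability (measurableTypeR R) R) :
  iid X F -> forall n (A : nat -> set R), (forall i, measurable (A i)) ->
  pr P (cylinder X n A) = \prod_(i < n) pr F (A i).
Proof.
move=> [indX distX] n A mA.
have := indX [fset i in iota 0 n]%fset A (fun i _ => mA i).
rewrite (perm_big (iota 0 n)); last first.
  apply: uniq_perm; [exact: fset_uniq|exact: iota_uniq|] => i.
  by rewrite inE.
rewrite (_ : iota 0 n = index_iota 0 n) ?big_mkord; last by rewrite /index_iota subn0.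
rewrite (eq_bigr (fun i : 'I_n => (pr F (A i))%:E)); last first.
  by move=> i _; rewrite -prE; [exact: (distX i _ (mA i))|exact: mA].
rewrite prodEFin => H; apply: EFin_inj; rewrite -H -prE.
  congr (P _); apply/seteqP; split=> t At i.
    by rewrite /= !inE mem_index_iota => /= ?; exact: At.
  by move=> ltin; apply: At; rewrite /= !inE mem_index_iota.
exact: measurable_cylinder.
Qed.

Lemma density_ge {R : realType} (F : probability (measurableTypeR R) R)
    (f : R -> R) (beta : R) (A : set R) :
  is_density F f -> 0 <= beta -> measurable A ->
  (forall x, A x -> beta <= f x) -> (beta%:E * lebesgue_measure A <= F A)%E.
Proof.
move=> [mf f0 FE] b0 mA bf; rewrite FE// -integral_cst//.
apply: ge0_le_integral => //.
by apply/measurable_EFinP; exact: measurable_funTS.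
Qed.

(** The endpoint types are left free because reflection about [M] turns left-closed cells into
    right-closed ones. *)
Lemma density_itv_ge {R : realType} (F : probability (measurableTypeR R) R)
    (f : R -> R) (beta a b : R) (ba bb : bool) :
  is_density F f -> 0 <= beta -> a < b ->
  (forall x, a <= x <= b -> beta <= f x) ->
  beta * (b - a) <= pr F [set` Interval (BSide ba a) (BSide bb b)].
Proof.
move=> hf b0 ab bf; rewrite -lee_fin -prE//.
have := @density_ge R F f beta [set` Interval (BSide ba a) (BSide bb b)] hf b0.
rewrite lebesgue_measure_itv/= lte_fin ab => H; apply: H => // x.
by case: ba bb => -[]; rewrite /= in_itv/= => /andP[? ?]; apply: bf; apply/andP; split; lra.
Qed.

(** The map [g] covers both sides of [M] at once, as [x - M] and as [M - x]. *)
Lemma trivIset_cells {R : realType} (K : nat) (h : R) (g : R -> R) :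
  0 < h ->
  trivIset setT (fun c : 'I_K => [set x | c%:R * h <= g x < c.+1%:R * h]).
Proof.
move=> h0; have lt_cell (c c' : 'I_K) y :
    c%:R * h <= y < c.+1%:R * h -> c'%:R * h <= y < c'.+1%:R * h -> (c <= c')%N.
  move=> /andP[cy _] /andP[_ yc'].
  by have := le_lt_trans cy yc'; rewrite ltr_pM2r// ltr_nat ltnS.
move=> c c' _ _ [x [xc xc']]; apply/val_inj/eqP.
by rewrite eqn_leq !(lt_cell _ _ (g x)).
Qed.

(** Both factors are bounded linearly: [(K - m) * (b * h) >= a * b / 2] and
    [1 - r >= m * b * h / 2]. Then [exprn_1B_le] turns the outer power into a reciprocal. The extra
    unit in [m.+1] absorbs the rounding of [a / h]. *)
Lemma collision_free_bound {R : realType} (a b h : R) (m : nat) :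
  0 < a -> 0 < b -> 0 < h -> (0 < m)%N -> a * b <= 1 ->
  m.+1%:R * h <= a / 2 -> m%:R * (b * h) <= 1 ->
  (1 - (Num.truncn (a / h) - m)%:R * (b * h) * (1 - (1 - b * h) ^+ m)) ^+ m
    <= 4 / (a * b ^+ 2 * (h * m%:R ^+ 2)).
Proof.
move=> a0 b0 h0 m0 ab1 mha mbh1; set K := Num.truncn _; set r := (1 - b * h) ^+ m.
have mR : 1 <= m%:R :> R by rewrite ler1n.
have /andP[Kle ltK] : K%:R <= a / h < K.+1%:R by apply: truncn_itv; rewrite divr_ge0 ?ltW.
rewrite ler_pdivlMr// in Kle; rewrite ltr_pdivrMr// -natr1 in ltK.
rewrite -natr1 in mha.
have mK : (m <= K)%N by rewrite -(ler_nat R) -(ler_pM2r h0); nra.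
have bh0 : 0 < b * h by rewrite mulr_gt0.
have bh1 : b * h <= 1 by nra.
have rle : r <= (1 + m%:R * (b * h))^-1 by apply: exprn_1B_le; rewrite ltW.
have r0 : 0 <= r by rewrite exprn_ge0// subr_ge0.
have z0 : 0 < m%:R * (b * h) by rewrite mulr_gt0// ltr0n.
(* For [z] in the unit interval, [1 / (1 + z) <= 1 - z / 2]. *)
have r1 : m%:R * (b * h) / 2 <= 1 - r.
  rewrite lerBrDr -lerBrDl; apply: (le_trans rle).
  rewrite -[leLHS]mul1r ler_pdivrMr; last by nra.
  by move: (m%:R * _) z0 mbh1 => z ? ?; nra.
set p := (K - m)%:R * (b * h).
have p1 : p <= 1.
  apply: le_trans ab1; rewrite /p natrB//.
  have : b * (K%:R * h) <= b * a by rewrite ler_wpM2l// ltW.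
  nra.
have p2 : a * b / 2 <= p.
  rewrite /p natrB//.
  have : b * (a / 2) <= b * ((K%:R - m%:R) * h) by rewrite ler_wpM2l ?ltW//; nra.
  nra.
have y0 : a * b / 2 * (m%:R * (b * h) / 2) <= p * (1 - r).
  by apply: ler_pM => //; apply: ltW; rewrite divr_gt0// mulr_gt0.
have q0 : 0 < a * b / 2 * (m%:R * (b * h) / 2).
  by apply: mulr_gt0; rewrite divr_gt0// mulr_gt0.
have y1 : p * (1 - r) <= 1.
  have p0 : 0 <= p by apply: le_trans p2; rewrite divr_ge0// mulr_ge0 ?ltW.
  have s0 : 0 <= 1 - r by lra.
  by apply: mulr_ile1 => //; rewrite gerBl.
apply: le_trans (exprn_1B_le _ _) _; first by rewrite y1 andbT; nra.
rewrite [leRHS](_ : _ = (m%:R * (a * b / 2 * (m%:R * (b * h) / 2)))^-1);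
  last by field; rewrite !lt0r_neq0 ?ltr0n.
rewrite lef_pV2 ?posrE; first by nra.
- by nra.
- by rewrite mulr_gt0// ltr0n.
Qed.

(** * Symmetric cells around [M] *)

Lemma measurable_pair_event {d : measure_display} {T : measurableType d}
    {R : realType} (P : probability T R) (X : nat -> {RV P >-> R}) (M e : R) n :
  measurable [set t | exists i j : 'I_n, `|(X i t + X j t) / 2 - M| <= e].
Proof.
rewrite (_ : [set t | _] = \bigcup_(i in [set: 'I_n]) \bigcup_(j in [set: 'I_n])
    [set t | `|(X i t + X j t) / 2 - M| <= e]); last first.
  apply/seteqP; split=> [t [i [j ij]]|t [i _ [j _ ij]]]; last by exists i, j.
  by exists i => //; exists j.
apply: fin_bigcup_measurable => [|i _]; first exact: finite_finset.
apply: fin_bigcup_measurable => [|j _]; first exact: finite_finset.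
rewrite -[X in measurable X]setTI; apply: measurable_fun_le => //.
apply: measurableT_comp => //; apply: measurable_funB => //.
by apply: measurable_funM => //; exact: measurable_funD.
Qed.

Lemma no_pair_le {d : measure_display} {T : measurableType d} {R : realType}
    (P : probability T R) (X : nat -> {RV P >-> R})
    (F : probability (measurableTypeR R) R) (f : R -> R) (M a b h : R) (m n : nat) :
  iid X F -> is_density F f -> 0 < a -> 0 < b -> 0 < h -> (0 < m)%N ->
  (m + m <= n)%N -> (forall x, M - a <= x <= M + a -> b <= f x) ->
  m.+1%:R * h <= a / 2 -> m%:R * (b * h) <= 1 ->
  pr P (~` [set t | exists i j : 'I_n, `|(X i t + X j t) / 2 - M| <= h])
    <= 4 / (a * b ^+ 2 * (h * m%:R ^+ 2)).
Proof.
move=> hX hf a0 b0 h0 m0 mmn fb mha mbh.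
(* The interval from [M] to [M + a] has mass at least [a * b]. *)
have ab1 : a * b <= 1.
  have aM : M < M + a by rewrite ltrDl.
  apply: (@le_trans _ _ (pr F `[M, M + a])); last exact: pr_le1.
  have := @density_itv_ge _ F f b M (M + a) true false hf (ltW b0) aM.
  rewrite (addrC M) addrK mulrC; apply => x /andP[Mx xMa]; apply: fb; lra.
apply: le_trans (collision_free_bound a0 b0 h0 m0 ab1 mha mbh).
set K := Num.truncn (a / h).
have Kh : K%:R * h <= a by rewrite -ler_pdivlMr// truncn_le// divr_ge0 ?ltW.
have cellE c x : (c%:R * h <= x - M < c.+1%:R * h) =
    (x \in `[M + c%:R * h, M + c.+1%:R * h[).
  by rewrite in_itv/= lerBrDl ltrBlDl.
have cellE' c x : (c%:R * h <= M - x < c.+1%:R * h) =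
    (x \in `]M - c.+1%:R * h, M - c%:R * h]).
  by rewrite in_itv/= lerBrDl ltrBlDl andbC; congr (_ && _); lra.
have cell_le (c : 'I_K) : 0 <= c%:R * h /\ c.+1%:R * h <= a.
  split; first by rewrite mulr_ge0// ltW.
  by apply: le_trans Kh; rewrite ler_pM2r// ler_nat.
have cell_lt (c : 'I_K) : c%:R * h < c.+1%:R * h by rewrite ltr_pM2r// ltr_nat.
pose C (c : 'I_K) := [set x | c%:R * h <= x - M < c.+1%:R * h].
pose D (c : 'I_K) := [set x | c%:R * h <= M - x < c.+1%:R * h].
have CE c : C c = `[M + c%:R * h, M + c.+1%:R * h[%classic.
  by apply/seteqP; split=> x; rewrite /C/= cellE.
have DE c : D c = `]M - c.+1%:R * h, M - c%:R * h]%classic.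
  by apply/seteqP; split=> x; rewrite /D/= cellE'.
apply: (@collision_free_le _ _ _ (measurableTypeR R) _ P F X _ _ K m C D).
- move=> i; exact: (measurable_funPT (X i)).
- by move=> k A mA; exact: pr_cylinder_iid.
- by move=> c; rewrite CE.
- by move=> c; rewrite DE.
- exact: trivIset_cells.
- exact: trivIset_cells.
- have bh0 : 0 <= b * h by rewrite mulr_ge0 ?ltW.
  by rewrite bh0; apply: le_trans mbh; rewrite ler_peMl ?ler1n.
- move=> c; have [c0 ca] := cell_le c; have clt := cell_lt c.
  have := @density_itv_ge _ F f b (M + c%:R * h) (M + c.+1%:R * h) true true hf
    (ltW b0).
  rewrite ltrD2l clt -CE => /(_ isT) H; apply: le_trans (H _).
    by rewrite -natr1; lra.
  by move=> x /andP[? ?]; apply: fb; lra.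
- move=> c; have [c0 ca] := cell_le c; have clt := cell_lt c.
  have := @density_itv_ge _ F f b (M - c.+1%:R * h) (M - c%:R * h) false false hf
    (ltW b0).
  rewrite ltrD2l ltrN2 clt -DE => /(_ isT) H; apply: le_trans (H _).
    by rewrite -natr1; lra.
  by move=> x /andP[? ?]; apply: fb; lra.
- exact/measurableC/measurable_pair_event.
(* Both [X i t - M] and [M - X j t] lie in one interval of length [h], so their difference, twice
   the deviation of the average from [M], is below [h]. *)
- move=> t i j c nE im /andP[mj jmm] /andP[ci1 ci2] /andP[cj1 cj2]; apply: nE.
  have ltin : (i < n)%N by apply: leq_trans im (leq_trans (leq_addr m m) mmn).
  have ltjn : (j < n)%N := leq_trans jmm mmn.
  exists (Ordinal ltin), (Ordinal ltjn) => /=.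
  move: ci2 cj2; rewrite -natr1 => ci2 cj2.
  by rewrite ler_norml; apply/andP; split; lra.
Qed.

(** * Choice of constants and conclusion for large [n] *)

Lemma half_bounds n : (1 < n)%N ->
  [/\ (0 < n./2)%N, (n./2 + n./2 <= n)%N & (n <= 3 * n./2)%N].
Proof. by move=> n1; split; lia. Qed.

Lemma powR_ge_near_infty {R : realType} (e c : R) : 0 < e -> 0 <= c ->
  exists N : nat, forall n : nat, (N <= n)%N -> c <= n%:R `^ e.
Proof.
move=> e0 c0; exists (Num.truncn (c `^ e^-1)).+1 => n Nn.
rewrite -[leLHS](@powRr1 R)// -[X in c `^ X](mulVf (lt0r_neq0 e0)) powRrM.
apply: ge0_ler_powR; rewrite ?nnegrE ?powR_ge0 ?ler0n// ?ltW//.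
by apply: lt_le_trans (truncnS_gt _) _; rewrite ler_nat.
Qed.

Theorem theorem7 (d : measure_display) (T : measurableType d) (R : realType)
    (P : probability T R) (X : nat -> {RV P >-> R})
    (F : probability (measurableTypeR R) R) (f : R -> R) (M : R)
    (hX : iid X F) (hf : is_density F f) (hM : is_median F M)
    (hfM : bounded_away_from0_near f M) :
  forall delta eps : R, 0 < delta -> 0 < eps ->
    exists N : nat, forall n : nat, (N <= n)%N ->
      ((1 - delta)%:E <=
        P [set t | exists i j : 'I_n,
             (`| (X i t + X j t) / 2 - M | <= 1 / (n%:R `^ (2 - eps)))%R])%E.
Proof.
move=> delta eps delta0 eps0; have [a [b [a0 b0 fb]]] := hfM.
(* A smaller exponent gives a narrower target, hence a smaller event; [e <= 1/2] ensures
   [e <= 1 - e]. *)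
pose e := Num.min eps (2^-1).
have e0 : 0 < e by rewrite lt_min eps0 invr_gt0 ltr0n.
have e_eps : e <= eps by rewrite ge_min lexx.
have e_half : e <= 2^-1 by rewrite ge_min lexx orbT.
(* One summand per requirement: [n * h <= a / 4], [n * h * b <= 1], and the final bound by [delta],
   where 36 is 4 from [no_pair_le] times 9 from [n <= 3 * m]. *)
pose c := 4 / a + b + 36 / (a * b ^+ 2 * delta).
have c1 : 0 < 4 / a by rewrite divr_gt0.
have c2 : 0 < 36 / (a * b ^+ 2 * delta) by rewrite divr_gt0// !mulr_gt0// exprn_gt0.
have c0 : 0 < c by apply: addr_gt0 => //; exact: addr_gt0.
have [N Nc] := powR_ge_near_infty e0 (ltW c0).
exists (maxn N 2) => n; rewrite geq_max => /andP[/Nc ne n2].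
have n1 : 1 <= n%:R :> R by rewrite ler1n; exact: ltnW.
have n0 : 0 < n%:R :> R by exact: lt_le_trans n1.
pose h : R := 1 / n%:R `^ (2 - e).
have h0 : 0 < h by rewrite divr_gt0// powR_gt0.
have hn2 : h * n%:R ^+ 2 = n%:R `^ e.
  rewrite /h div1r -powRN opprB -powR_mulrn ?ltW// -powRD ?subrK//.
  by rewrite (gt_eqF n0) implybT.
(* Here [n * h] is [n] to the power [e - 1], and [c] is at most [n] to the power [e], hence to the
   power [1 - e]. *)
have hn : n%:R * h * c <= 1.
  apply: (@le_trans _ _ (n%:R * h * n%:R `^ (1 - e))).
    apply: ler_wpM2l; first by rewrite mulr_ge0 ?ltW.
    apply: (le_trans ne).
    by apply: ler_powR => //; lra.
  rewrite /h div1r -powRN -[X in X * _ * _]powRr1 ?ler0n// -!powRD;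
    rewrite ?(gt_eqF n0) ?implybT//.
  rewrite (_ : 1 - (2 - e) + (1 - e) = 0); last by ring.
  by rewrite powRr0.
set E := [set t | _].
have mE : measurable E by exact: measurable_pair_event.
have EE : [set t | exists i j : 'I_n, `|(X i t + X j t) / 2 - M| <= h] `<=` E.
  move=> t [i [j ij]]; exists i, j; apply: (le_trans ij).
  by rewrite /h !div1r lef_pV2 ?posrE ?powR_gt0//; apply: ler_powR => //; lra.
have mEh := @measurable_pair_event _ _ _ P X M h n.
rewrite prE// lee_fin; apply: le_trans (le_pr P mEh mE EE).
rewrite lerBlDr -lerBlDl -pr_setC//.
pose m := n./2.
have [m0 mn nm] : [/\ (0 < m)%N, (m + m <= n)%N & (n <= 3 * m)%N].
  exact: half_bounds.
have mnR' : m%:R <= n%:R :> R by rewrite ler_nat (leq_trans (leq_addr m m)).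
have mnR : m.+1%:R <= 2 * n%:R :> R by rewrite -natr1; lra.
have nh0 : 0 < n%:R * h by rewrite mulr_gt0.
have nha : n%:R * h <= a / 4.
  rewrite -[leRHS]invf_div -[leRHS]mul1r ler_pdivlMr//; apply: le_trans hn.
  by rewrite ler_pM2l// /c; lra.
have nhb : n%:R * h * b <= 1.
  by apply: le_trans hn; rewrite ler_pM2l// /c; lra.
apply: (le_trans (no_pair_le hX hf a0 b0 h0 m0 mn _ _ _)).
- by move=> x xM; apply: fb; rewrite in_itv.
- have := ler_wpM2r (ltW h0) mnR; lra.
- have := ler_wpM2r (ltW (mulr_gt0 b0 h0)) mnR'; lra.
have abd0 : 0 < a * b ^+ 2 by rewrite mulr_gt0// exprn_gt0.
have hm0 : 0 < h * m%:R ^+ 2 by rewrite mulr_gt0// exprn_gt0// ltr0n.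
rewrite (ler_pdivrMr _ _ (mulr_gt0 abd0 hm0)).
(* The left side is a summand of [c], and [n] to the power [e] equals [h * n ^+ 2], which is at most
   [9 * (h * m ^+ 2)]. *)
have : 36 / (a * b ^+ 2 * delta) <= 9 * (h * m%:R ^+ 2).
  apply: (@le_trans _ _ (n%:R `^ e)); first by apply: le_trans ne; rewrite /c; lra.
  rewrite -hn2 [leRHS]mulrCA ler_pM2l// (_ : 9 = 3 ^+ 2); last by ring.
  by rewrite -exprMn lerXn2r ?nnegrE ?mulr_ge0// -natrM ler_nat.
rewrite (ler_pdivrMr _ _ (mulr_gt0 abd0 delta0)); lra.
Qed.
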